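(* For every positive integer $\ell$ there is a constant $C_\ell>0$ depending only on $\ell$ such that the following holds for every positive integer $n$ and every Sidon set $S=\{a_1<a_2<\cdots<a_t\}\subset\{1,2,\ldots,n\}$ (with $t=|S|$): if $t\geqslant n^{1/2}-n^{1/4}$, then $$\left|\sum_{i=1}^t a_i^\ell-\frac{1}{\ell+1}tn^{\ell}\right|\leqslant C_\ell\, n^{\ell+3/8},$$ and if $t<n^{1/2}-n^{1/4}$, then $$\left|\sum_{i=1}^t a_i^\ell-\frac{1}{\ell+1}tn^{\ell}\right|\leqslant C_\ell\, n^{\ell+1/4}\sqrt{n^{1/2}-t}.$$
   Context: A set $S\subset\{1,2,\ldots,n\}$ is called a Sidon set if all the sums $a+b$ with $a,b\in S$ are different (up to the order of the summands, i.e. the sums $a+b$ with $a\leqslant b$, $a,b\in S$, are pairwise distinct). *)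

(* Defs.v *)
From mathcomp Require Import all_boot finmap.
Set Implicit Arguments.
Unset Strict Implicit.
Unset Printing Implicit Defensive.

Definition sidon (S : {fset nat}) : Prop :=
  forall a b c d : nat,
    a \in S -> b \in S -> c \in S -> d \in S ->
    a <= b -> c <= d -> a + b = c + d -> a = c /\ b = d.

(* Main.v *)
Require Import Defs.
From mathcomp Require Import all_boot all_order all_algebra finmap.
From mathcomp Require Import reals exp.
From mathcomp Require Import zify ring lra.
Set Implicit Arguments.
Unset Strict Implicit.
Unset Printing Implicit Defensive.
Import Order.TTheory GRing.Theory Num.Theory.
Local Open Scope fset_scope.
Local Open Scope ring_scope.

(** Write [t] for the size of [S] and [N] for [n + u], and let [f j] count the
    elements of [S] in the window [(j - u, j]], for [0 <= j < N]: equivalently,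
    [f] is the sum of the indicators of the translates [S], [S + 1], ...,
    [S + (u - 1)].

    Every element lies in exactly [u] windows, so [f] has mean [t u / N].  Since
    differences of distinct elements of a Sidon set are distinct, two different
    translates of [S] meet in at most one point; hence the sum of [f j ^ 2] is
    at most [t u + u ^ 2] ([sum_window_sqr]), and the squared deviations of [f]
    from its mean add up to at most [u ^ 2 (t / u + 1 - t ^ 2 / N)]
    ([variance_window]).  This is small when [t] is close to [sqrt n]: [S] is
    then evenly spread at scale [u].

    To read off moments, compare three sums: [u] times the sum of [a ^ l]; the
    sum of [f j * j ^ l], which differs from it only in that each [a] is
    smeared over [a, ..., a + u - 1]; and [t u / N] times the sum of [j ^ l],
    which is nearly [u t n ^ l / (l + 1)].  The second and third differ by the
    sum of [(f j - t u / N) * j ^ l], and Cauchy-Schwarz bounds that by the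
    variance ([moment_error]).  The smearing costs [t u n ^ (l - 1)] and the
    fluctuation [n ^ l sqrt (n (t / u + u / n + 1 - t ^ 2 / n))], up to
    constants; the choice [u ~ n ^ (3/4)] balances [t / u] against [u / n].

    With [q = n ^ (1/4)] the resulting error is of order [n ^ l q sqrt M],
    where [M] is the larger of [q] and the deficit [q ^ 2 - t]
    ([moment_estimate]).  The two regimes of the theorem are the two possible
    values of that maximum. *)

(** * Windows and translates of a Sidon set *)

(** The guard [i <= j] keeps truncated subtraction from creating spurious
    members of the translate. *)
Definition translate (S : {fset nat}) (i : nat) : pred nat :=
  fun j => (i <= j)%N && ((j - i)%N \in S).

Definition window (S : {fset nat}) (u j : nat) : nat :=
  (\sum_(i < u) translate S i j)%N.

Lemma sum_translate (V : nmodType) (S : {fset nat}) (n u i : nat)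
    (g : nat -> V) :
  (forall a, a \in S -> (a <= n)%N) -> (i < u)%N ->
  \sum_(j < n + u | translate S i j) g j = \sum_(a <- S) g (a + i)%N.
Proof.
move=> Sn iu; rewrite -(big_mkord (translate S i) g) /index_iota subn0.
rewrite -big_filter -(big_map (addn^~ i) xpredT g).
apply/perm_big/uniq_perm => [||j].
- exact/filter_uniq/iota_uniq.
- by rewrite map_inj_uniq ?fset_uniq//; exact: addIn.
rewrite mem_filter mem_iota add0n leq0n /=; apply/idP/mapP.
  case/andP=> /andP[ij jS] _; exists (j - i)%N => //; by rewrite subnK.
case=> a aS ->; rewrite /translate leq_addl addnK aS /=.
by have := Sn _ aS; lia.
Qed.

Lemma sum_window (R : comPzRingType) (S : {fset nat}) (n u : nat)
    (g : nat -> R) :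
  (forall a, a \in S -> (a <= n)%N) ->
  \sum_(j < n + u) (window S u j)%:R * g j =
  \sum_(i < u) \sum_(a <- S) g (a + i)%N.
Proof.
move=> Sn; under eq_bigr do rewrite natr_sum mulr_suml.
rewrite exchange_big; apply: eq_bigr => i _ /=.
rewrite -(sum_translate _ Sn (ltn_ord i)) [RHS]big_mkcond /=.
by apply: eq_bigr => j _; case: translate; rewrite ?mul1r ?mul0r.
Qed.

(** A common point [j] of two translates by [i] and [i'] writes [i' - i] as the
    difference [(j - i) - (j - i')] of two elements of [S]; in a Sidon set this
    representation is unique. *)
Lemma sidon_translate_inter (S : {fset nat}) (i i' j k : nat) :
  sidon S -> i != i' ->
  translate S i j -> translate S i' j -> translate S i k -> translate S i' k ->
  j = k.
Proof.
move=> sS ne /andP[ij jS] /andP[i'j jS'] /andP[ik kS] /andP[i'k kS'].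
wlog lt : i i' ne ij jS i'j jS' ik kS i'k kS' / (i < i')%N.
  move=> H; have [lt|gt|eq] := ltngtP i i'; first exact: (H i i').
    by apply: (H i' i) => //; rewrite eq_sym.
  by rewrite eq eqxx in ne.
(* the case splits put the two equal sums in the increasing order that [sidon]
   asks for *)
have /orP[le|le] := leq_total j k.
  have := sS (j - i')%N (k - i)%N; case: (leqP (j - i) (k - i'))%N => h.
    by move=> /(_ (j - i)%N (k - i')%N) []//; lia.
  by move=> /(_ (k - i')%N (j - i)%N) []//; lia.
have := sS (k - i')%N (j - i)%N; case: (leqP (k - i) (j - i'))%N => h.
  by move=> /(_ (k - i)%N (j - i')%N) []//; lia.
by move=> /(_ (j - i')%N (k - i)%N) []//; lia.
Qed.

(** Expanding the square gives the sizes of the intersections of all pairs of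
    translates: each of the [u] diagonal pairs contributes [#|` S|], and every
    other pair contributes at most 1. *)
Lemma sum_window_sqr (S : {fset nat}) (n u : nat) :
  (forall a, a \in S -> (a <= n)%N) -> sidon S ->
  (\sum_(j < n + u) window S u j ^ 2 <= #|` S| * u + u ^ 2)%N.
Proof.
move=> Sn sS.
pose c i i' := (\sum_(j < n + u) translate S i j * translate S i' j)%N.
have -> : (\sum_(j < n + u) window S u j ^ 2 =
           \sum_(i < u) \sum_(i' < u) c i i')%N.
  under eq_bigr do rewrite -mulnn big_distrlr.
  by rewrite exchange_big; apply: eq_bigr => i _; exact: exchange_big.
have diag (i : 'I_u) : c i i = #|` S|.
  have := sum_translate (fun=> 1%N) Sn (ltn_ord i).
  rewrite /GRing.zero /GRing.add /= sum1_size => <-; rewrite [RHS]big_mkcond.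
  by apply: eq_bigr => j _; case: translate.
have offdiag (i i' : 'I_u) : i != i' -> (c i i' <= 1)%N.
  move=> ne; have [j0 /andP[h h']|none] :=
    pickP (fun j : 'I_(n + u) => translate S i j && translate S i' j).
    rewrite /c (bigD1 j0)//= h h' big1 // => j ne0.
    apply/eqP; rewrite muln_eq0 !eqb0 -negb_and.
    apply: contra ne0 => /andP[k k']; apply/eqP/val_inj.
    exact: (sidon_translate_inter sS ne).
  by rewrite /c big1 // => j _; have := none j; do 2!case: translate.
apply: (@leq_trans (\sum_(i < u) (#|` S| + u))%N); last first.
  by rewrite sum_nat_const card_ord; lia.
apply: leq_sum => i _; rewrite (bigD1 i)//= diag leq_add2l.
apply: (@leq_trans (\sum_(i' < u | i' != i) 1)%N).
  by apply: leq_sum => i' ne; apply: offdiag; rewrite eq_sym.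
rewrite -[leqRHS](card_ord u) sum1_card; exact: max_card.
Qed.

(** * Finite sums *)

Lemma sum_sqr_dev (R : fieldType) (N : nat) (f : nat -> R) :
  N%:R != 0 :> R ->
  \sum_(j < N) (f j - (\sum_(i < N) f i) / N%:R) ^+ 2 =
  \sum_(j < N) f j ^+ 2 - (\sum_(j < N) f j) ^+ 2 / N%:R.
Proof.
move=> N0; set s := \sum_(i < N) f i; pose m := s / N%:R.
under eq_bigr do rewrite sqrrB.
rewrite big_split sumrB /= sumrMnl -mulr_suml -/s sumr_const card_ord.
rewrite -[_ ^+ 2 *+ N]mulr_natl.
by field.
Qed.

Lemma sqr_sum_le (R : realFieldType) (N : nat) (f : nat -> R) :
  (\sum_(j < N) f j) ^+ 2 <= N%:R * \sum_(j < N) f j ^+ 2.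
Proof.
case: N => [|N]; first by rewrite !big_ord0 expr0n mul0r.
rewrite mulrC -ler_pdivrMr ?ltr0n// -subr_ge0 -sum_sqr_dev ?pnatr_eq0//.
by apply: sumr_ge0 => j _; exact: sqr_ge0.
Qed.

Lemma norm_sum_mul_le (R : rcfType) (N : nat) (f g : nat -> R) (B : R) :
  0 <= B -> (forall j, (j < N)%N -> `|g j| <= B) ->
  `|\sum_(j < N) f j * g j| <= B * Num.sqrt (N%:R * \sum_(j < N) f j ^+ 2).
Proof.
move=> B0 gB; apply: le_trans (ler_norm_sum _ _ _) _.
apply: (@le_trans _ _ (B * \sum_(j < N) `|f j|)).
  rewrite mulr_sumr; apply: ler_sum => j _.
  by rewrite normrM mulrC ler_wpM2r ?gB.
rewrite ler_wpM2l// -[leLHS]ger0_norm ?sumr_ge0// -sqrtr_sqr ler_sqrt.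
  rewrite (le_trans (sqr_sum_le N (fun j => `|f j|)))//.
  by under eq_bigr do rewrite real_normK ?num_real//.
by rewrite mulr_ge0 ?sumr_ge0// => j _; exact: sqr_ge0.
Qed.

(** The mean value inequality for powers, from the geometric factorisation of
    [y ^+ k.+1 - x ^+ k.+1]. *)
Lemma subrXS_bounds (R : realDomainType) (x y : R) (k : nat) :
  0 <= x -> x <= y ->
  k.+1%:R * (y - x) * x ^+ k <= y ^+ k.+1 - x ^+ k.+1
    <= k.+1%:R * (y - x) * y ^+ k.
Proof.
move=> x0 xy; have y0 := le_trans x0 xy.
have cst (z : R) : k.+1%:R * (y - x) * z ^+ k =
    (y - x) * \sum_(i < k.+1) z ^+ (k - i) * z ^+ i.
  rewrite mulrAC mulrC; congr (_ * _).
  rewrite mulr_natl -[in LHS](card_ord k.+1) -sumr_const.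
  by apply: eq_bigr => i _; rewrite -exprD subnK// -ltnS.
rewrite subrXX !cst; apply/andP; split; rewrite ler_wpM2l ?subr_ge0//;
  apply: ler_sum => i _.
- by rewrite ler_wpM2r ?exprn_ge0 ?lerXn2r.
- by rewrite ler_wpM2l ?exprn_ge0 ?lerXn2r.
Qed.

Lemma sum_pow_bounds (R : realDomainType) (N k : nat) :
  k.+1%:R * \sum_(j < N) j%:R ^+ k <= N%:R ^+ k.+1 :> R /\
  N%:R ^+ k.+1 <= k.+1%:R * (\sum_(j < N) j%:R ^+ k + N%:R ^+ k) :> R.
Proof.
elim: N => [|N [IH1 IH2]].
  by rewrite !big_ord0 mulr0 add0r expr0n mulr_ge0 ?exprn_ge0.
have le : N%:R <= N.+1%:R :> R by rewrite ler_nat.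
have /andP[] := subrXS_bounds k (ler0n _ _) le.
rewrite big_ord_recr /= -[in _ - N%:R]natr1 addrAC subrr add0r mulr1.
by move: IH1 IH2; rewrite !mulrDr => *; split; lra.
Qed.

(** * Moments in terms of the window length *)

Section Moment.
Variables (R : realType) (n u : nat) (S : {fset nat}).
Hypotheses (u0 : (0 < u)%N) (Sn : forall a, a \in S -> (a <= n)%N).
Hypothesis sS : sidon S.
Let t : R := #|` S|%:R.
Let N : R := (n + u)%:R.

Lemma variance_window :
  \sum_(j < n + u) ((window S u j)%:R - t * u%:R / N) ^+ 2 <=
  u%:R ^+ 2 * (t / u%:R + 1 - t ^+ 2 / N).
Proof.
have uR : u%:R != 0 :> R by rewrite pnatr_eq0 -lt0n.
have NR : N != 0 by rewrite pnatr_eq0 -lt0n; lia.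
have sumf : \sum_(j < n + u) (window S u j)%:R = t * u%:R.
  under eq_bigr do rewrite -[_%:R]mulr1.
  rewrite (sum_window u (fun=> 1) Sn) sumr_const card_ord.
  rewrite -[in LHS](natr_sum _ S xpredT (fun=> 1%N)) sum1_size mulr_natr //.
have := sum_sqr_dev (fun j => (window S u j)%:R : R) NR.
rewrite sumf => ->.
have : (\sum_(j < n + u) (window S u j)%:R ^+ 2 : R) <= t * u%:R + u%:R ^+ 2.
  under eq_bigr do rewrite -natrX.
  by rewrite -natr_sum -natrM -natrX -natrD ler_nat sum_window_sqr.
have alg (s v M : R) : v != 0 -> M != 0 ->
    v ^+ 2 * (s / v + 1 - s ^+ 2 / M) = s * v + v ^+ 2 - (s * v) ^+ 2 / M.
  by move=> v0 M0; field; apply/andP.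
by rewrite alg// -/N lerD2r.
Qed.

(** The first error term is the cost of smearing every element of [S] over
    [u] consecutive integers and of replacing [N] by [n]; the second is the
    fluctuation of the window counts. *)
Lemma moment_error k :
  `|\sum_(a <- S) a%:R ^+ k.+1 - t * n%:R ^+ k.+1 / k.+2%:R| <=
  k.+2%:R * t * u%:R * N ^+ k +
  N ^+ k.+1 * Num.sqrt (N * (t / u%:R + 1 - t ^+ 2 / N)).
Proof.
have uR : 0 < u%:R :> R by rewrite ltr0n.
have NR : 0 < N by rewrite ltr0n; lia.
have t0 : 0 <= t by rewrite ler0n.
have cardS (c : R) : \sum_(a <- S) c = t * c.
  by rewrite big_const_seq count_predT iter_addr_0 mulr_natl.
pose smeared : R := \sum_(i < u) \sum_(a <- S) (a + i)%:R ^+ k.+1.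
pose pw : R := \sum_(j < n + u) j%:R ^+ k.+1.
(* each [(a + i) ^+ k.+1] exceeds [a ^+ k.+1] by at most [k.+1 u N ^+ k] *)
have smear : 0 <= smeared - u%:R * \sum_(a <- S) a%:R ^+ k.+1 <=
    k.+1%:R * t * u%:R ^+ 2 * N ^+ k.
  have -> : u%:R * \sum_(a <- S) a%:R ^+ k.+1 =
      \sum_(i < u) \sum_(a <- S) a%:R ^+ k.+1 :> R.
    by rewrite sumr_const card_ord mulr_natl.
  have -> : k.+1%:R * t * u%:R ^+ 2 * N ^+ k =
      \sum_(i < u) \sum_(a <- S) k.+1%:R * u%:R * N ^+ k.
    by rewrite cardS sumr_const card_ord -[RHS]mulr_natl; ring.
  rewrite -sumrB; apply/andP; split.
    apply: sumr_ge0 => i _; rewrite -sumrB; apply: sumr_ge0 => a _.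
    by rewrite subr_ge0 lerXn2r ?nnegrE ?ler0n// ler_nat leq_addr.
  apply: ler_sum => i _; rewrite -sumrB big_seq [leRHS]big_seq.
  apply: ler_sum => a aS.
  have le : a%:R <= (a + i)%:R :> R by rewrite ler_nat leq_addr.
  have /andP[_ /le_trans->//] := subrXS_bounds k (ler0n _ _) le.
  rewrite natrD addrAC subrr add0r -natrD.
  have iu : i%:R <= u%:R :> R by rewrite ler_nat ltnW.
  have aN : (a + i)%:R <= N by rewrite ler_nat leq_add ?Sn 1?ltnW.
  rewrite ler_pM ?mulr_ge0 ?exprn_ge0 ?ler0n// ?ler_wpM2l ?ler0n//.
  by rewrite lerXn2r// nnegrE ?ler0n ?ltW.
have dev : `|smeared - t * u%:R / N * pw| <=
    u%:R * (N ^+ k.+1 * Num.sqrt (N * (t / u%:R + 1 - t ^+ 2 / N))).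
  have -> : smeared - t * u%:R / N * pw =
      \sum_(j < n + u) ((window S u j)%:R - t * u%:R / N) * j%:R ^+ k.+1.
    under eq_bigr do rewrite mulrBl.
    by rewrite sumrB -mulr_sumr (sum_window u (fun j => j%:R ^+ k.+1) Sn).
  apply: le_trans (@norm_sum_mul_le _ _
    (fun j => (window S u j)%:R - t * u%:R / N) (fun j => j%:R ^+ k.+1)
    (N ^+ k.+1) _ _) _.
  - by rewrite exprn_ge0 ?ltW.
  - move=> j jN; rewrite ger0_norm ?exprn_ge0//.
    by rewrite lerXn2r ?nnegrE ?ler0n ?ltW// ltr_nat.
  rewrite mulrCA ler_wpM2l ?exprn_ge0 ?(ltW NR)//.
  have uE : u%:R = Num.sqrt (u%:R ^+ 2) :> R by rewrite sqrtr_sqr ger0_norm.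
  rewrite [X in _ <= X * _]uE -sqrtrM ?sqr_ge0// ler_wsqrtr//.
  by rewrite [leRHS]mulrCA ler_wpM2l ?(ltW NR)//; exact: variance_window.
have main : `|t * u%:R / N * pw - u%:R * (t * n%:R ^+ k.+1 / k.+2%:R)| <=
     t * u%:R ^+ 2 * N ^+ k.
  have [hi lo] := sum_pow_bounds R (n + u) k.+1.
  have le : n%:R <= N by rewrite ler_nat leq_addr.
  have /andP[_ top] := subrXS_bounds k (ler0n _ _) le.
  have bot : n%:R ^+ k.+1 <= N ^+ k.+1.
    by rewrite lerXn2r ?nnegrE ?ler0n ?(ltW NR).
  have -> : t * u%:R / N * pw - u%:R * (t * n%:R ^+ k.+1 / k.+2%:R) =
     t * u%:R * (pw / N - n%:R ^+ k.+1 / k.+2%:R).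
    by rewrite mulrBr; congr (_ - _); ring.
  have -> : t * u%:R ^+ 2 * N ^+ k = t * u%:R * (u%:R * N ^+ k) by ring.
  rewrite normrM (ger0_norm (mulr_ge0 t0 (ltW uR))).
  rewrite ler_wpM2l ?mulr_ge0 ?ler0n//.
  rewrite -/pw -/N in hi lo.
  have NN : N - n%:R = u%:R by rewrite /N natrD addrAC subrr add0r.
  rewrite NN in top.
  have u1 : 1 <= u%:R :> R by rewrite ler1n.
  have k2 : 0 < k.+2%:R :> R by [].
  have hi' : k.+2%:R * (pw / N) <= N ^+ k.+1.
    by rewrite mulrA ler_pdivrMr// -exprSr.
  have lo' : N ^+ k.+1 <= k.+2%:R * (pw / N + N ^+ k).
    have -> : pw / N + N ^+ k = (pw + N ^+ k.+1) / N.
      by rewrite mulrDl exprSr mulfK ?gt_eqF.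
    by rewrite mulrA ler_pdivlMr// -exprSr.
  have Nk : 0 <= N ^+ k by rewrite exprn_ge0 ?ltW.
  have NuN : k.+2%:R * N ^+ k <= k.+2%:R * (u%:R * N ^+ k).
    by rewrite ler_wpM2l ?ler0n// ler_peMl.
  have k12 : k.+1%:R * u%:R * N ^+ k <= k.+2%:R * (u%:R * N ^+ k).
    by rewrite -mulrA ler_wpM2r ?mulr_ge0 ?ler0n// ler_nat.
  rewrite -(ler_pM2l k2) -{1}(gtr0_norm k2) -normrM mulrBr.
  rewrite [_ * (n%:R ^+ _ / _)]mulrC mulfVK ?gt_eqF//.
  rewrite mulrDr in lo'.
  by rewrite ler_norml; apply/andP; split; lra.
rewrite -(ler_pM2l uR) -{1}(gtr0_norm uR) -normrM [leRHS]mulrDr mulrBr.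
rewrite (_ : u%:R * (_ * _ ^+ k) =
  k.+1%:R * t * u%:R ^+ 2 * N ^+ k + t * u%:R ^+ 2 * N ^+ k); last first.
  by rewrite -[k.+2%:R]natr1; ring.
move: smear dev main; rewrite !ler_norml.
move: (u%:R * \sum_(a <- S) _) (u%:R * (t * _ / _)) (u%:R * (N ^+ _ * _)).
move: (t * u%:R / N * pw) (t * _ ^+ 2 * _) (k.+1%:R * _ * _ ^+ 2 * _).
by move=> E F G A B D /andP[? ?] /andP[? ?] /andP[? ?]; apply/andP; split; lra.
Qed.

(** Nonnegativity of the variance bounds the size of a Sidon set: this is the
    Erdos-Turan argument. *)
Lemma variance_factor_ge0 : 0 <= t / u%:R + 1 - t ^+ 2 / N.
Proof.
have uR : 0 < u%:R ^+ 2 :> R by rewrite exprn_gt0// ltr0n.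
rewrite -(pmulr_rge0 _ uR); apply: le_trans variance_window.
by apply: sumr_ge0 => j _; exact: sqr_ge0.
Qed.

End Moment.

(** * The window of length n^(3/4) *)

(** Here [q ^+ 4] is the length of the ambient interval and [u] is [q ^+ 3] up
    to a factor 2.  Multiplied out, the left-hand side of the last inequality
    is [N t / u + u + (q ^+ 4 - t ^+ 2)]: the first two terms are
    of order [q ^+ 3], and the last one is at most [2 q ^+ 2] times the deficit
    [q ^+ 2 - t] when that is positive. *)
Lemma window_tradeoff (R : realFieldType) (q u t M : R) :
  1 <= q -> q ^+ 3 < 2 * u -> u <= q ^+ 3 -> 0 <= t ->
  0 <= t / u + 1 - t ^+ 2 / (q ^+ 4 + u) -> q <= M -> q ^+ 2 - t <= M ->
  t <= 6 * q ^+ 2 /\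
  (q ^+ 4 + u) * (t / u + 1 - t ^+ 2 / (q ^+ 4 + u)) <= 36 * q ^+ 2 * M.
Proof.
move=> q1 uq qu t0 V0 qM LM.
have q0 : 0 < q by lra.
have q3 : 0 < q ^+ 3 by rewrite exprn_gt0.
have q4 : q ^+ 3 <= q ^+ 4 by rewrite [leRHS]exprS ler_peMl// ltW.
have u0 : 0 < u by lra.
have N0 : 0 < q ^+ 4 + u by lra.
have XE : (q ^+ 4 + u) * (t / u + 1 - t ^+ 2 / (q ^+ 4 + u)) =
    (q ^+ 4 + u) / u * t + (q ^+ 4 + u) - t ^+ 2.
  by field; rewrite !gt_eqF.
have Nu : (q ^+ 4 + u) / u <= 4 * q.
  rewrite ler_pdivrMr//.
  have : q * q ^+ 3 <= q * (2 * u) by rewrite ler_pM2l// ltW.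
  rewrite -exprS; nra.
have X0 : 0 <= (q ^+ 4 + u) / u * t + (q ^+ 4 + u) - t ^+ 2.
  by rewrite -XE mulr_ge0// ltW.
have Nut : (q ^+ 4 + u) / u * t <= 4 * q * t by rewrite ler_wpM2r.
have q2 : q <= q ^+ 2 by rewrite expr2 ler_peMl// ltW.
have t6 : t <= 6 * q ^+ 2.
  (* otherwise [t ^+ 2] would exceed [4 q t + 2 q ^+ 4], contradicting [X0] *)
  rewrite leNgt; apply/negP => tq.
  have : 6 * q ^+ 2 * t < t * t by rewrite ltr_pM2r//; nra.
  have : q * t <= q ^+ 2 * t by rewrite ler_wpM2r.
  have : q ^+ 2 * (6 * q ^+ 2) <= q ^+ 2 * t.
    by rewrite ler_wpM2l ?sqr_ge0// ltW.
  have -> : q ^+ 2 * (6 * q ^+ 2) = 6 * q ^+ 4 by ring.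
  move: X0; rewrite -expr2; lra.
split=> //; rewrite XE.
have qt : q * t <= 6 * q ^+ 3.
  by rewrite exprS mulrCA ler_pM2l.
have qM3 : q ^+ 3 <= q ^+ 2 * M by rewrite exprSr ler_wpM2l// sqr_ge0.
have LM2 : q ^+ 4 - t ^+ 2 <= 2 * q ^+ 2 * M.
  have -> : q ^+ 4 - t ^+ 2 = (q ^+ 2 - t) * (q ^+ 2 + t) by ring.
  have M0 : 0 < M by lra.
  have q20 : 0 < q ^+ 2 by lra.
  have [tq|tq] := leP t (q ^+ 2); last first.
    apply: (@le_trans _ _ 0); first by apply: mulr_le0_ge0; lra.
    by rewrite !mulr_ge0//; lra.
  by rewrite mulrC; apply: ler_pM; lra.
lra.
Qed.

(** The parameter [M] stands for any common upper bound of [q] and of the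
    deficit; both regimes of the theorem are instances. *)
Lemma moment_estimate (R : realType) (n k : nat) (S : {fset nat}) (q M : R) :
  (0 < n)%N -> (forall a, a \in S -> (a <= n)%N) -> sidon S ->
  0 <= q -> n%:R = q ^+ 4 -> q <= M -> q ^+ 2 - #|` S|%:R <= M ->
  `|\sum_(a <- S) a%:R ^+ k.+1 - #|` S|%:R * n%:R ^+ k.+1 / k.+2%:R| <=
  6 * k.+4%:R * 2 ^+ k * n%:R ^+ k.+1 * (q * Num.sqrt M).
Proof.
move=> n0 Sn sS q0 nq qM LM.
have q1 : 1 <= q.
  by rewrite -(@ler_pXn2r _ 4) ?nnegrE// expr1n -nq ler1n.
have q31 : 1 <= q ^+ 3 by rewrite exprn_ege1.
have q3 : 0 <= q ^+ 3 by rewrite exprn_ge0.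
pose u := Num.trunc (q ^+ 3).
have /andP[uq qu] := truncn_itv q3; rewrite -/u in uq qu.
have u0 : (0 < u)%N by rewrite truncn_gt0.
have u1 : 1 <= u%:R :> R by rewrite ler1n.
have uq2 : q ^+ 3 < 2 * u%:R by move: qu; rewrite -natr1; lra.
have V0 := variance_factor_ge0 R u0 Sn sS.
have err := moment_error R u0 Sn sS k.
rewrite natrD nq in V0; rewrite natrD nq in err.
have [t6 X] := window_tradeoff q1 uq2 uq (ler0n _ _) V0 qM LM.
rewrite nq; apply: le_trans err _.
have t0 : 0 <= #|` S|%:R :> R by [].
move: {V0} (#|` S|%:R : R) t0 t6 X LM => t t0 t6 X LM.
have q4 : q ^+ 3 <= q ^+ 4 by rewrite [leRHS]exprS ler_peMl.
set N := q ^+ 4 + u%:R in X *; set Y := N * _ in X *.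
have N0 : 0 <= N by rewrite /N; lra.
have N2 : N <= 2 * q ^+ 4 by rewrite /N; lra.
have Nx j : N ^+ j <= 2 ^+ j * (q ^+ 4) ^+ j.
  by rewrite -exprMn lerXn2r ?nnegrE// (le_trans N0).
have M1 : 1 <= Num.sqrt M.
  by rewrite -sqrtr1 ler_wsqrtr//; lra.
have sX : Num.sqrt Y <= 6 * q * Num.sqrt M.
  have -> : 6 * q * Num.sqrt M = Num.sqrt (36 * q ^+ 2 * M).
    have -> : 36 * q ^+ 2 = (6 * q) ^+ 2 by ring.
    by rewrite sqrtrM ?sqr_ge0// sqrtr_sqr ger0_norm// mulr_ge0.
  exact: ler_wsqrtr.
set Q := (q ^+ 4) ^+ k.+1.
have Q0 : 0 <= Q by rewrite !exprn_ge0.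
have b1 : k.+2%:R * t * u%:R * N ^+ k <=
    k.+2%:R * 6 * 2 ^+ k * Q * q * Num.sqrt M.
  apply: (@le_trans _ _ (k.+2%:R * 6 * 2 ^+ k * Q * q)); last first.
    by rewrite ler_peMr// !mulr_ge0 ?exprn_ge0.
  have -> : k.+2%:R * 6 * 2 ^+ k * Q * q =
      k.+2%:R * (6 * q ^+ 2) * q ^+ 3 * (2 ^+ k * (q ^+ 4) ^+ k).
    by rewrite /Q exprSr; ring.
  by rewrite !ler_pM ?mulr_ge0 ?exprn_ge0 ?ler0n.
have b2 : N ^+ k.+1 * Num.sqrt Y <= 2 ^+ k.+1 * Q * (6 * q * Num.sqrt M).
  by rewrite ler_pM ?exprn_ge0 ?sqrtr_ge0.
apply: (le_trans (lerD b1 b2)); rewrite le_eqVlt; apply/orP; left; apply/eqP.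
by rewrite [in LHS]exprS -[k.+4]addn2 natrD; ring.
Qed.

Theorem theorem1 (R : realType) (l : nat) (hl : (0 < l)%N) :
  exists2 C : R, 0 < C &
    forall (n : nat) (S : {fset nat}),
      (0 < n)%N ->
      (forall a : nat, a \in S -> (1 <= a <= n)%N) ->
      sidon S ->
      let t := #|` S| in
      (n%:R `^ (1 / 2) - n%:R `^ (1 / 4) <= t%:R :> R ->
         `| \sum_(a <- S) a%:R ^+ l - 1 / (l.+1)%:R * t%:R * n%:R ^+ l |
           <= C * n%:R `^ (l%:R + 3 / 8)) /\
      (t%:R < n%:R `^ (1 / 2) - n%:R `^ (1 / 4) :> R ->
         `| \sum_(a <- S) a%:R ^+ l - 1 / (l.+1)%:R * t%:R * n%:R ^+ l |
           <= C * n%:R `^ (l%:R + 1 / 4)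
                * Num.sqrt (n%:R `^ (1 / 2) - t%:R)).
Proof.
case: l hl => // k _; exists (6 * k.+4%:R * 2 ^+ k).
  by rewrite !mulr_gt0 ?exprn_gt0.
move=> n S n0 Sn sS t.
have {}Sn a : a \in S -> (a <= n)%N by move/Sn => /andP[].
pose q : R := n%:R `^ (1 / 4).
have q0 : 0 <= q by exact: powR_ge0.
have nR : 0 <= n%:R :> R by [].
have nq : n%:R = q ^+ 4.
  by rewrite -powR_mulrn// -powRrM (_ : 1 / 4 * 4 = 1) ?powRr1//; field.
have n2 : n%:R `^ (1 / 2) = q ^+ 2.
  by rewrite -powR_mulrn// -powRrM; congr (_ `^ _); field.
have nD (x y : R) : n%:R `^ (x + y) = n%:R `^ x * n%:R `^ y.
  by rewrite powRD// pnatr_eq0 (gtn_eqF n0) implybT.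
have n8 : n%:R `^ (3 / 8) = q * Num.sqrt q.
  rewrite -powR12_sqrt// -powRrM -nD; congr (_ `^ _); by field.
have mainE : 1 / k.+2%:R * t%:R * n%:R ^+ k.+1 =
    #|` S|%:R * n%:R ^+ k.+1 / k.+2%:R :> R.
  by rewrite div1r mulrC mulrA mulrAC -mulrA [RHS]mulrAC mulrC.
rewrite n2 -/q !nD powR_mulrn// -/q n8 mainE; split=> tq.
  have LM : q ^+ 2 - t%:R <= q by lra.
  have := moment_estimate k n0 Sn sS q0 nq (lexx q) LM.
  by rewrite !mulrA.
have qM : q <= q ^+ 2 - t%:R by lra.
have := moment_estimate k n0 Sn sS q0 nq qM (lexx _).
by rewrite !mulrA.
Qed.
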